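(* Let $k$ be a field of characteristic different from $2$ and $3$, and let $C$ be a smooth plane quartic over $k$ admitting a $k$-rational point. Then $C$ is isomorphic (over $k$) to a plane quartic curve of one of the following forms, with all coefficients $m_i\in k$: (1) $m_1 x^4 + m_2 x^3 y + m_4 x^2 y^2 + m_6 x^2 z^2 + m_7 x y^3 + x y^2 z + m_{11} y^4 + m_{12} y^3 z + y^2 z^2 + y z^3 = 0$; (2) $m_1 x^4 + m_2 x^3 y + m_4 x^2 y^2 + m_6 x^2 z^2 + x y^3 + m_{11} y^4 + m_{12} y^3 z + y^2 z^2 + y z^3 = 0$; (3) $m_1 x^4 + m_2 x^3 y + m_4 x^2 y^2 + m_6 x^2 z^2 + m_{11} y^4 + m_{12} y^3 z + y^2 z^2 + y z^3 = 0$; (4) $m_1 x^4 + m_2 x^3 y + m_4 x^2 y^2 + m_6 x^2 z^2 + x y^3 + x y^2 z + m_{11} y^4 + m_{12} y^3 z + y z^3 = 0$; (5) $m_1 x^4 + m_2 x^3 y + m_4 x^2 y^2 + m_6 x^2 z^2 + x y^2 z + m_{11} y^4 + m_{12} y^3 z + y z^3 = 0$; (6) $x^4 + m_2 x^3 y + m_4 x^2 y^2 + m_6 x^2 z^2 + m_7 x y^3 + m_{11} y^4 + m_{12} y^3 z + y z^3 = 0$; (7) $m_2 x^3 y + m_4 x^2 y^2 + m_6 x^2 z^2 + m_7 x y^3 + m_{11} y^4 + m_{12} y^3 z + y z^3 = 0$; (8) $x^3 z + m_4 x^2 y^2 + m_7 x y^3 + m_8 x y^2 z + x y z^2 + m_{11}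 y^4 + m_{12} y^3 z + m_{13} y^2 z^2 + y z^3 = 0$; (9) $x^3 z + m_4 x^2 y^2 + m_7 x y^3 + m_8 x y^2 z + m_{11} y^4 + m_{12} y^3 z + m_{13} y^2 z^2 + y z^3 = 0$; (10) $x^4 + m_4 x^2 y^2 + m_5 x^2 y z + m_7 x y^3 + m_8 x y^2 z + m_{11} y^4 + m_{12} y^3 z + y z^3 = 0$. *)

(* Defs.v *)
From HB Require Import structures.
From mathcomp Require Import all_boot all_order all_algebra.
From mathcomp.multinomials Require Export mpoly.

Set Implicit Arguments.
Unset Strict Implicit.
Unset Printing Implicit Defensive.

Import GRing.Theory.
Local Open Scope ring_scope.

(* A plane projective curve over k is represented by its homogeneous equation
   F : {mpoly k[3]}, and stands for the scheme Proj k[x, y, z] / (F). *)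

Section PlaneCurves.

Variable k : fieldType.
Implicit Types F G : {mpoly k[3]}.

Definition plane_quartic F : Prop := F != 0 /\ F \is 4.-homog.

(* Homogeneous coordinates over an extension L of k of a point of the curve. *)
Definition curve_point (L : fieldType) (f : {rmorphism k -> L}) F
    (v : 'I_3 -> L) : Prop :=
  (exists i, v i != 0) /\ mmap f v F = 0.

Definition has_rational_point F : Prop :=
  exists v : 'I_3 -> k, curve_point idfun F v.

(* Smoothness over k is geometric: the Jacobian criterion is required at the
   points with coordinates in every field extension of k. *)
Definition smooth_curve F : Prop :=
  forall (L : fieldType) (f : {rmorphism k -> L}) (v : 'I_3 -> L),
    curve_point f F v -> exists i : 'I_3, mmap f v F^`M(i) != 0.

Definition in_ideal F (p : {mpoly k[3]}) : Prop :=
  exists q : {mpoly k[3]}, p = q * F.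

Definition triple := 3.-tuple {mpoly k[3]}.

(* Equality of (P_0 : P_1 : P_2) and (Q_0 : Q_1 : Q_2) on the curve F = 0. *)
Definition proportional_on F (P Q : triple) : Prop :=
  forall i j : 'I_3, in_ideal F (tnth P i * tnth Q j - tnth P j * tnth Q i).

(* A morphism over k from the curve F = 0 to the curve G = 0.  A member P of
   charts defines the map (P_0 : P_1 : P_2) on the open set of the curve where
   P_0, P_1, P_2 do not vanish simultaneously; these open sets cover the
   curve and the maps agree on overlaps. *)
Record curve_morphism F G := CurveMorphism {
  charts : seq triple;
  charts_homog : forall P : triple, P \in charts ->
    exists d : nat, forall i : 'I_3, tnth P i \is d.-homog;
  charts_into : forall P : triple, P \in charts -> in_ideal F (G \mPo P);
  charts_agree : forall P Q : triple, P \in charts -> Q \in charts ->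
    proportional_on F P Q;
  charts_cover : forall (L : fieldType) (f : {rmorphism k -> L})
      (v : 'I_3 -> L), curve_point f F v ->
    exists2 P : triple, P \in charts & exists i : 'I_3, mmap f v (tnth P i) != 0
}.

Definition comp_triple (Q P : triple) : triple := [tuple tnth Q i \mPo P | i < 3].

Definition id_triple : triple := [tuple 'X_i | i < 3].

(* psi after phi is the identity of the curve F = 0. *)
Definition left_inverse F G (phi : curve_morphism F G)
    (psi : curve_morphism G F) : Prop :=
  forall P Q : triple, P \in charts phi -> Q \in charts psi ->
    proportional_on F (comp_triple Q P) id_triple.

Definition isomorphic_curves F G : Prop :=
  exists (phi : curve_morphism F G) (psi : curve_morphism G F),
    left_inverse phi psi /\ left_inverse psi phi.

End PlaneCurves.

(* Main.v *)
Require Import Defs.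
From mathcomp Require Import all_boot all_order all_algebra.
From mathcomp Require Import fieldext ring.

(* Move the rational point to (0 : 0 : 1) and its tangent line to y = 0, with
   y z^3 having coefficient 1.  On that line the quartic restricts to
   x^2 (m1 x^2 + m3 x z + m6 z^2), and smoothness is used only for the existence
   of the tangent line and for the nonvanishing of this restriction.  If
   m6 <> 0, the shears in z along x, in z along y and in x along y kill m3, m5
   and m9; if m6 = 0 and m3 <> 0 (a flex) they kill m1, m2 and m5; if
   m3 = m6 = 0 (a hyperflex) they kill m9, m13 and m2.  Rescaling the
   coordinates normalizes the remaining coefficients. *)

Set Implicit Arguments.
Unset Strict Implicit.
Unset Printing Implicit Defensive.

Import GRing.Theory.
Local Open Scope ring_scope.

(** * Linear changes of coordinates, the isomorphisms they induce, and nonsingularity *)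

Section LinearEquivalence.

Variable k : fieldType.
Implicit Types (F G p q : {mpoly k[3]}) (P Q R : triple k).

Lemma tripleP P Q :
  tnth P 0 = tnth Q 0 -> tnth P 1 = tnth Q 1 -> tnth P 2%:R = tnth Q 2%:R ->
  P = Q.
Proof.
move=> e0 e1 e2; apply: eq_from_tnth => -[[|[|[|//]]] i_lt].
- by rewrite (_ : Ordinal i_lt = 0) //; apply: val_inj.
- by rewrite (_ : Ordinal i_lt = 1) //; apply: val_inj.
- by rewrite (_ : Ordinal i_lt = 2%:R) //; apply: val_inj.
Qed.

Lemma mmap_comp (L : fieldType) (f : {rmorphism k -> L}) (v : 'I_3 -> L) p P :
  mmap f v (p \mPo P) = mmap f (fun i => mmap f v (tnth P i)) p.
Proof.
rewrite comp_mpolyEX raddf_sum [RHS]/mmap /=.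
apply: eq_bigr => m _; rewrite mmapZ comp_mpolyX rmorph_prod /mmap1 /=.
by congr (_ * _); apply: eq_bigr => i _; rewrite rmorphXn.
Qed.

Lemma comp_mpoly_comp p P Q : p \mPo P \mPo Q = p \mPo comp_triple P Q.
Proof.
rewrite (comp_mpolyEX p P) (comp_mpolyEX p (comp_triple P Q)) raddf_sum /=.
apply: eq_bigr => m _; rewrite comp_mpolyZ !comp_mpolyX rmorph_prod /=.
by congr (_ *: _); apply: eq_bigr => i _; rewrite rmorphXn tnth_mktuple.
Qed.

Lemma mmap_homog_at0 (L : fieldType) (f : {rmorphism k -> L}) (v : 'I_3 -> L)
    d p : p \is d.+1.-homog -> v =1 (fun=> 0) -> mmap f v p = 0.
Proof.
move=> /dhomogP p_hom v0; rewrite /mmap big_seq big1 // => m /p_hom m_deg.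
have [i mi0] : exists i, m i != 0%N.
  apply/existsP; apply: contra_eqT m_deg; rewrite negb_exists => /forallP m0.
  have -> : m = 0%MM by apply/mnmP => i; rewrite mnm0E; apply/eqP/negPn/m0.
  by rewrite /= mdeg0.
by rewrite /mmap1 (bigD1 i) //= v0 expr0n (negPf mi0) mul0r mulr0.
Qed.

Definition linear_triple P := forall i, tnth P i \is 1.-homog.

Lemma comp_linear p d P :
  p \is d.-homog -> linear_triple P -> p \mPo P \is d.-homog.
Proof.
move=> /dhomogP p_hom P_lin; rewrite comp_mpolyEX big_seq.
apply: rpred_sum => m /p_hom /= <-; apply: rpredZ; rewrite comp_mpolyX mdegE.
elim/big_ind2: _ => [|d1 p1 d2 p2|i _]; first exact: dhomog1.
- exact: dhomogM.
- by rewrite -[m i]mul1n; have := dhomogMn (m i) (P_lin i); rewrite !mul1n.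
Qed.

Definition inverse_triples P Q :=
  [/\ linear_triple P, linear_triple Q,
      comp_triple P Q = id_triple k & comp_triple Q P = id_triple k].

(** Proportional equations define the same curve, whence the scalar [c]. The substitution [P]
    carries points of [G = 0] to points of [F = 0]. *)
Definition linearly_equivalent F G :=
  exists2 P, exists Q, inverse_triples P Q &
  exists2 c, c != 0 & G = c *: (F \mPo P).

Lemma comp_id p : p \mPo id_triple k = p.
Proof. exact: comp_mpoly_id. Qed.

Lemma linearly_equivalent_refl F : linearly_equivalent F F.
Proof.
exists (id_triple k).
  exists (id_triple k); split.
  1,2: by move=> i; rewrite tnth_mktuple dhomogX /= mdeg1.
  1,2: by apply: eq_from_tnth => i; rewrite tnth_mktuple comp_id.
by exists 1; rewrite ?oner_neq0 // scale1r comp_id.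
Qed.

Lemma linearly_equivalent_sym F G :
  linearly_equivalent F G -> linearly_equivalent G F.
Proof.
case=> P [Q [P_lin Q_lin PQ QP]] [c c0 ->].
exists Q; first by exists P.
exists c^-1; first by rewrite invr_eq0.
by rewrite comp_mpolyZ scalerA mulVf // scale1r comp_mpoly_comp PQ comp_id.
Qed.

Lemma comp_tripleA P Q R :
  comp_triple (comp_triple P Q) R = comp_triple P (comp_triple Q R).
Proof.
by apply: eq_from_tnth => i; rewrite !tnth_mktuple comp_mpoly_comp.
Qed.

Lemma comp_triple1 P : comp_triple P (id_triple k) = P.
Proof. by apply: eq_from_tnth => i; rewrite tnth_mktuple comp_id. Qed.

Lemma linearly_equivalent_trans F G H :
  linearly_equivalent F G -> linearly_equivalent G H ->
  linearly_equivalent F H.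
Proof.
case=> P [P' [P_lin P'_lin PP' P'P]] [c c0 ->].
case=> Q [Q' [Q_lin Q'_lin QQ' Q'Q]] [d d0 ->].
exists (comp_triple P Q).
  exists (comp_triple Q' P'); split.
  - by move=> i; rewrite tnth_mktuple; apply: comp_linear.
  - by move=> i; rewrite tnth_mktuple; apply: comp_linear.
  - by rewrite -comp_tripleA (comp_tripleA P) QQ' comp_triple1.
  - by rewrite -comp_tripleA (comp_tripleA Q') P'P comp_triple1.
exists (d * c); first by rewrite mulf_neq0.
by rewrite comp_mpolyZ scalerA comp_mpoly_comp.
Qed.

(** [Q] undoes [P] and, being linear, fixes the zero vector; so [P] cannot send a nonzero vector to
    zero. Hence one linear chart is defined on the whole curve, as [charts_cover] asks. *)
Lemma inverse_triples_neq0 (L : fieldType) (f : {rmorphism k -> L})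
    (v : 'I_3 -> L) P Q :
  inverse_triples P Q -> (exists i, v i != 0) ->
  exists i, mmap f v (tnth P i) != 0.
Proof.
case=> _ Q_lin _ QP [i vi0]; apply/existsP; apply: contra_neqT vi0.
rewrite negb_exists => /forallP Pv0.
have -> : v i = mmap f v (tnth Q i \mPo P).
  have := congr1 (fun T => mmap f v (tnth T i)) QP.
  by rewrite /= !tnth_mktuple mmapX mmap1U => ->.
rewrite mmap_comp; apply: (@mmap_homog_at0 _ _ _ 0) => // j.
exact/eqP/negPn/Pv0.
Qed.

Lemma linear_curve_morphism F G P Q :
  inverse_triples P Q -> in_ideal F (G \mPo P) ->
  exists phi : curve_morphism F G, charts phi = [:: P].
Proof.
move=> PQ FP; unshelve eexists (@CurveMorphism k F G [:: P] _ _ _ _) => //.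
- by case: PQ => P_lin _ _ _ _ /[1!inE]/eqP ->; exists 1%N.
- by move=> _ /[1!inE]/eqP ->.
- move=> _ _ /[1!inE]/eqP -> /[1!inE]/eqP -> i j.
  by exists 0; rewrite mul0r [X in X - _]mulrC subrr.
move=> L f v [v0 _]; exists P; first by rewrite inE.
exact: inverse_triples_neq0 PQ v0.
Qed.

Lemma proportional_id F : proportional_on F (id_triple k) (id_triple k).
Proof. by move=> i j; exists 0; rewrite mul0r mulrC subrr. Qed.

Lemma linearly_equivalent_isomorphic F G :
  linearly_equivalent F G -> isomorphic_curves F G.
Proof.
(* The substitution in a linear equivalence of [F] and [G] maps the curve of [G] to that of [F],
   while [phi] goes the other way; hence the symmetry. *)
move=> /linearly_equivalent_sym [P [Q PQ]] [c c0 F_eq].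
have [P_lin Q_lin PQ1 QP1] := PQ.
have G_eq : F \mPo Q = c *: G.
  by rewrite F_eq comp_mpolyZ comp_mpoly_comp PQ1 comp_id.
have [|phi phiE] := @linear_curve_morphism F G P Q PQ.
  exists c^-1%:MP; rewrite mul_mpolyC F_eq scalerA mulVf // scale1r //.
have QP : inverse_triples Q P by [].
have [|psi psiE] := @linear_curve_morphism G F Q P QP.
  by exists c%:MP; rewrite mul_mpolyC.
exists phi, psi; split=> A B; rewrite ?phiE ?psiE !inE => /eqP -> /eqP ->.
  by rewrite QP1; apply: proportional_id.
by rewrite PQ1; apply: proportional_id.
Qed.

(* F does not lie in the square of the ideal of a geometric point; two
   products suffice for the singular points met below. *)
Definition nonsingular F := forall (L : fieldType) (f : {rmorphism k -> L})
    (v : 'I_3 -> L) p q p' q', (exists i, v i != 0) ->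
  mmap f v p = 0 -> mmap f v q = 0 -> mmap f v p' = 0 -> mmap f v q' = 0 ->
  F <> p * q + p' * q'.

(** By the Leibniz rule, a product of two polynomials vanishing at a point has all its partial
    derivatives vanishing there, so the Jacobian criterion would fail. *)
Lemma smooth_nonsingular F : smooth_curve F -> nonsingular F.
Proof.
move=> F_smooth L f v p q p' q' v0 pv qv p'v q'v F_eq.
have [|i /eqP[]] := F_smooth L f v.
  by split=> //; rewrite F_eq rmorphD !rmorphM /= pv p'v !mul0r addr0.
rewrite F_eq mderivD !mderivM !rmorphD !rmorphM /= pv qv p'v q'v.
by rewrite !(mul0r, mulr0, addr0).
Qed.

(** A decomposition into products of polynomials vanishing at [v] pulls back along [P] to one at the
    image of [v] under [Q]. With nonsingularity stated through such decompositions, no chain rule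
    enters. *)
Lemma linearly_equivalent_nonsingular F G :
  linearly_equivalent F G -> nonsingular F -> nonsingular G.
Proof.
move=> /linearly_equivalent_sym [P [Q PQ]] [c c0 F_eq] F_ns.
move=> L f v p q p' q' v0 pv qv p'v q'v G_eq.
have [P_lin Q_lin PQ1 QP1] := PQ.
have QP : inverse_triples Q P by [].
pose w i := mmap f v (tnth Q i).
have at_w (r : {mpoly k[3]}) : mmap f v r = 0 -> mmap f w (r \mPo P) = 0.
  by rewrite -mmap_comp comp_mpoly_comp PQ1 comp_id.
apply: (F_ns L f w (c *: (p \mPo P)) (q \mPo P) (c *: (p' \mPo P)) (q' \mPo P)).
- exact: inverse_triples_neq0 QP v0.
- by rewrite mmapZ at_w ?mulr0.
- exact: at_w.
- by rewrite mmapZ at_w ?mulr0.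
- exact: at_w.
by rewrite F_eq G_eq rmorphD !rmorphM /= -!scalerAl scalerDr.
Qed.

End LinearEquivalence.

(* The coefficient written m_i in the normal forms is s`_(i - 1). *)
Definition quartic_form (k : fieldType) (A : comNzRingType)
    (f : {rmorphism k -> A}) (s : seq k) (x y z : A) : A :=
  f s`_0 * x ^+ 4 + f s`_1 * (x ^+ 3 * y) + f s`_2 * (x ^+ 3 * z)
  + f s`_3 * (x ^+ 2 * y ^+ 2) + f s`_4 * (x ^+ 2 * y * z)
  + f s`_5 * (x ^+ 2 * z ^+ 2) + f s`_6 * (x * y ^+ 3)
  + f s`_7 * (x * y ^+ 2 * z) + f s`_8 * (x * y * z ^+ 2)
  + f s`_9 * (x * z ^+ 3) + f s`_10 * y ^+ 4 + f s`_11 * (y ^+ 3 * z)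
  + f s`_12 * (y ^+ 2 * z ^+ 2) + f s`_13 * (y * z ^+ 3) + f s`_14 * z ^+ 4.

(** * Action of linear substitutions on the fifteen coefficients *)

Section FormIdentities.

Variables (k : fieldType) (A : comNzRingType) (f : {rmorphism k -> A}).
Implicit Types (s t : seq k) (x y z : A).

(** The cases [c = 1] and [t] empty give sums and scalar multiples, so a combination of quartic
    monomials is again a quartic form. *)
Lemma quartic_form_lin c s t x y z :
  quartic_form f (mkseq (fun i => c * s`_i + t`_i) 15) x y z
  = f c * quartic_form f s x y z + quartic_form f t x y z.
Proof. rewrite /quartic_form /=; ring. Qed.

Lemma quartic_form_nil x y z : quartic_form f [::] x y z = 0.
Proof. by rewrite /quartic_form !nth_nil; ring. Qed.

Lemma quartic_form_monomial i j l x y z : (i + (j + l) = 4)%N ->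
  exists s, x ^+ i * y ^+ j * z ^+ l = quartic_form f s x y z.
Proof.
move: i j l => [|[|[|[|[|i]]]]] [|[|[|[|[|j]]]]] [|[|[|[|[|l]]]]] //= _.
(* The case split meets the monomials in reverse coefficient order, from z^4 to x^4; [ncons n 0
   [:: 1]] is the unit vector with its 1 at position [n]. *)
- by exists (ncons 14 0 [:: 1]); rewrite /quartic_form /=; ring.
- by exists (ncons 13 0 [:: 1]); rewrite /quartic_form /=; ring.
- by exists (ncons 12 0 [:: 1]); rewrite /quartic_form /=; ring.
- by exists (ncons 11 0 [:: 1]); rewrite /quartic_form /=; ring.
- by exists (ncons 10 0 [:: 1]); rewrite /quartic_form /=; ring.
- by exists (ncons 9 0 [:: 1]); rewrite /quartic_form /=; ring.
- by exists (ncons 8 0 [:: 1]); rewrite /quartic_form /=; ring.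
- by exists (ncons 7 0 [:: 1]); rewrite /quartic_form /=; ring.
- by exists (ncons 6 0 [:: 1]); rewrite /quartic_form /=; ring.
- by exists (ncons 5 0 [:: 1]); rewrite /quartic_form /=; ring.
- by exists (ncons 4 0 [:: 1]); rewrite /quartic_form /=; ring.
- by exists (ncons 3 0 [:: 1]); rewrite /quartic_form /=; ring.
- by exists (ncons 2 0 [:: 1]); rewrite /quartic_form /=; ring.
- by exists (ncons 1 0 [:: 1]); rewrite /quartic_form /=; ring.
- by exists (ncons 0 0 [:: 1]); rewrite /quartic_form /=; ring.
Qed.

(* The coefficients (m10, m14, m15) = (0, 1, 0) say that the quartic passes
   through (0 : 0 : 1) with tangent line y = 0. *)
Lemma quartic_form_shear_zx e m1 m2 m3 m4 m5 m6 m7 m8 m9 m11 m12 m13 x y z :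
  quartic_form f [:: m1; m2; m3; m4; m5; m6; m7; m8; m9; 0; m11; m12; m13; 1]
    x y (z + f e * x)
  = quartic_form f
      [:: m1 + e * m3 + e ^+ 2 * m6; m2 + e * m5 + e ^+ 2 * m9 + e ^+ 3;
          m3 + 2 * e * m6; m4 + e * m8 + e ^+ 2 * m13;
          m5 + 2 * e * m9 + 3 * e ^+ 2; m6; m7 + e * m12; m8 + 2 * e * m13;
          m9 + 3 * e; 0; m11; m12; m13; 1] x y z.
Proof. rewrite /quartic_form /=; ring. Qed.

Lemma quartic_form_shear_zy e m1 m2 m3 m4 m5 m6 m7 m8 m9 m11 m12 m13 x y z :
  quartic_form f [:: m1; m2; m3; m4; m5; m6; m7; m8; m9; 0; m11; m12; m13; 1]
    x y (z + f e * y)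
  = quartic_form f
      [:: m1; m2 + e * m3; m3; m4 + e * m5 + e ^+ 2 * m6; m5 + 2 * e * m6; m6;
          m7 + e * m8 + e ^+ 2 * m9; m8 + 2 * e * m9; m9; 0;
          m11 + e * m12 + e ^+ 2 * m13 + e ^+ 3;
          m12 + 2 * e * m13 + 3 * e ^+ 2; m13 + 3 * e; 1] x y z.
Proof. rewrite /quartic_form /=; ring. Qed.

Lemma quartic_form_shear_xy e m1 m2 m3 m4 m5 m6 m7 m8 m9 m11 m12 m13 x y z :
  quartic_form f [:: m1; m2; m3; m4; m5; m6; m7; m8; m9; 0; m11; m12; m13; 1]
    (x + f e * y) y z
  = quartic_form f
      [:: m1; m2 + 4 * e * m1; m3; m4 + 6 * e ^+ 2 * m1 + 3 * e * m2;
          m5 + 3 * e * m3; m6;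
          m7 + 4 * e ^+ 3 * m1 + 3 * e ^+ 2 * m2 + 2 * e * m4;
          m8 + 3 * e ^+ 2 * m3 + 2 * e * m5; m9 + 2 * e * m6; 0;
          m11 + e ^+ 4 * m1 + e ^+ 3 * m2 + e ^+ 2 * m4 + e * m7;
          m12 + e ^+ 3 * m3 + e ^+ 2 * m5 + e * m8;
          m13 + e ^+ 2 * m6 + e * m9; 1] x y z.
Proof. rewrite /quartic_form /=; ring. Qed.

(** The scaling multiplies y z^3 by b. Taking b out as a common factor restores its coefficient 1
    and leaves the factor a^i b^(j-1) on the coefficient of x^i y^j z^l. *)
Lemma quartic_form_scale a b m1 m2 m3 m4 m5 m6 m7 m8 m9 m11 m12 m13 x y z :
  b != 0 ->
  quartic_form f [:: m1; m2; m3; m4; m5; m6; m7; m8; m9; 0; m11; m12; m13; 1]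
    (f a * x) (f b * y) z
  = f b * quartic_form f
      [:: a ^+ 4 / b * m1; a ^+ 3 * m2; a ^+ 3 / b * m3; a ^+ 2 * b * m4;
          a ^+ 2 * m5; a ^+ 2 / b * m6; a * b ^+ 2 * m7; a * b * m8; a * m9; 0;
          b ^+ 3 * m11; b ^+ 2 * m12; b * m13; 1] x y z.
Proof.
move=> b0; have bV c : f b * f (c / b) = f c.
  by rewrite -rmorphM mulrC divfK.
rewrite /quartic_form /= !(mulrDr (f b)) !(mulrA (f b)).
rewrite ![a ^+ _ / b * _]mulrAC !bV; ring.
Qed.

(** Meant for turning s_9 x + s_13 y, the linear form cutting out the tangent line at (0 : 0 : 1),
    into y. *)
Lemma quartic_form_shear_yx a b s x y z :
  quartic_form f s x (f a * y + f b * x) z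
  = quartic_form f
      [:: s`_0 + b * s`_1 + b ^+ 2 * s`_3 + b ^+ 3 * s`_6 + b ^+ 4 * s`_10;
          a * s`_1 + 2 * a * b * s`_3 + 3 * a * b ^+ 2 * s`_6
            + 4 * a * b ^+ 3 * s`_10;
          s`_2 + b * s`_4 + b ^+ 2 * s`_7 + b ^+ 3 * s`_11;
          a ^+ 2 * s`_3 + 3 * a ^+ 2 * b * s`_6 + 6 * a ^+ 2 * b ^+ 2 * s`_10;
          a * s`_4 + 2 * a * b * s`_7 + 3 * a * b ^+ 2 * s`_11;
          s`_5 + b * s`_8 + b ^+ 2 * s`_12;
          a ^+ 3 * s`_6 + 4 * a ^+ 3 * b * s`_10;
          a ^+ 2 * s`_7 + 3 * a ^+ 2 * b * s`_11;
          a * s`_8 + 2 * a * b * s`_12;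
          s`_9 + b * s`_13; a ^+ 4 * s`_10; a ^+ 3 * s`_11; a ^+ 2 * s`_12;
          a * s`_13; s`_14] x y z.
Proof. rewrite /quartic_form /=; ring. Qed.

Lemma quartic_form_swap s x y z :
  quartic_form f s y x z
  = quartic_form f
      [:: s`_10; s`_6; s`_11; s`_3; s`_7; s`_12; s`_1; s`_4; s`_8; s`_13;
          s`_0; s`_2; s`_5; s`_9; s`_14] x y z.
Proof. rewrite /quartic_form /=; ring. Qed.

End FormIdentities.

(** Substitution of polynomials and evaluation at a point are both instances of [g]. *)
Lemma quartic_form_morph (k : fieldType) (A B : comNzRingType)
    (f : {rmorphism k -> A}) (g : {rmorphism A -> B})
    (h : {rmorphism k -> B}) s x y z :
  (forall c, g (f c) = h c) ->
  g (quartic_form f s x y z) = quartic_form h s (g x) (g y) (g z).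
Proof. by move=> gf; rewrite /quartic_form !(rmorphD, rmorphM, rmorphXn) !gf. Qed.

(* A cubic without a root is irreducible, so it has a root in a stem field;
   the double negation avoids deciding whether it has a root in k. *)
Lemma cubic_root_extension (k : fieldType) (a b c : k) :
  ~ forall (L : fieldType) (f : {rmorphism k -> L}) (t : L),
      f c + f b * t + f a * t ^+ 2 + t ^+ 3 != 0.
Proof.
move=> no_root; pose p := Poly [:: c; b; a; 1].
have pE : p = [:: c; b; a; 1] :> seq k.
  by rewrite /p (PolyK (c := 0)) //= oner_neq0.
have p_irr : irreducible_poly p.
  apply: cubic_irreducible => [|t]; first by rewrite pE.
  apply: contra (no_root k idfun t) => /rootP; rewrite horner_Poly /= => <-.
  by apply/eqP; ring.
have [L _ [t /rootP + _]] := irredp_FAdjoin p_irr.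
rewrite map_Poly horner_Poly /= => root_t.
have /eqP[] := no_root L (GRing.in_alg L) t.
by rewrite -[RHS]root_t /= scale1r; ring.
Qed.

(** * Quartic polynomials and explicit invertible substitutions *)

Section PlaneQuartics.

Variable k : fieldType.
Implicit Types (F G p q r : {mpoly k[3]}) (P Q : triple k) (s t : seq k).

Local Notation x := ('X_(0 : 'I_3) : {mpoly k[3]}).
Local Notation y := ('X_(1 : 'I_3) : {mpoly k[3]}).
Local Notation z := ('X_(2%:R : 'I_3) : {mpoly k[3]}).
Local Notation const := (@mpolyC 3 k).

Definition quartic s := quartic_form const s x y z.

Lemma mpolyX3 (m : 'X_{1..3}) :
  'X_[m] = x ^+ m 0 * y ^+ m 1 * z ^+ m 2%:R :> {mpoly k[3]}.
Proof.
rewrite mpolyXE_id !big_ord_recl big_ord0 mulr1 mulrA.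
by congr (_ ^+ m _ * _ ^+ m _ * _ ^+ m _); apply: val_inj.
Qed.

Lemma mdeg3 (m : 'X_{1..3}) : mdeg m = (m 0%R + (m 1%R + m 2%:R))%N.
Proof.
rewrite mdegE !big_ord_recl big_ord0 addn0.
by congr (m _ + (m _ + m _))%N; apply: val_inj.
Qed.

Lemma homog4_quartic F : F \is 4.-homog -> exists s, F = quartic s.
Proof.
move=> /dhomogP F_hom; rewrite (mpolyE F) big_seq.
elim/big_ind: _ => [|p q [s ->] [t ->]|m /F_hom].
- by exists [::]; rewrite [RHS]quartic_form_nil.
- exists (mkseq (fun i => 1 * s`_i + t`_i) 15).
  by rewrite /quartic quartic_form_lin mul1r.
rewrite /= mdeg3 mpolyX3 => /(quartic_form_monomial const x y z) [s ->].
exists (mkseq (fun i => F@_m * s`_i + [::]`_i) 15).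
by rewrite /quartic quartic_form_lin quartic_form_nil addr0 mul_mpolyC.
Qed.

Lemma comp_x p q r : x \mPo [tuple p; q; r] = p.
Proof. by rewrite comp_mpolyXU. Qed.

Lemma comp_y p q r : y \mPo [tuple p; q; r] = q.
Proof. by rewrite comp_mpolyXU. Qed.

Lemma comp_z p q r : z \mPo [tuple p; q; r] = r.
Proof. by rewrite comp_mpolyXU. Qed.

Lemma quartic_comp s p q r :
  quartic s \mPo [tuple p; q; r] = quartic_form const s p q r.
Proof.
rewrite /quartic (quartic_form_morph (h := const)) => [|c]; rewrite [LHS]/=.
  by rewrite comp_x comp_y comp_z.
exact: comp_mpolyC.
Qed.

Lemma homogX i : ('X_i : {mpoly k[3]}) \is 1.-homog.
Proof. by rewrite dhomogX /= mdeg1. Qed.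

Lemma inverse_tuples p q r p' q' r' :
  p \is 1.-homog -> q \is 1.-homog -> r \is 1.-homog ->
  p' \is 1.-homog -> q' \is 1.-homog -> r' \is 1.-homog ->
  (let T := [tuple p'; q'; r'] in
   [/\ p \mPo T = x, q \mPo T = y & r \mPo T = z]) ->
  (let T := [tuple p; q; r] in
   [/\ p' \mPo T = x, q' \mPo T = y & r' \mPo T = z]) ->
  inverse_triples [tuple p; q; r] [tuple p'; q'; r'].
Proof.
move=> p1 q1 r1 p'1 q'1 r'1 [? ? ?] [? ? ?].
split; try by case=> [[|[|[|//]]] ?].
- by apply: tripleP; rewrite !tnth_mktuple.
- by apply: tripleP; rewrite !tnth_mktuple.
Qed.

Lemma comp_addZ p q c P :
  (p + c%:MP * q) \mPo P = p \mPo P + c%:MP * (q \mPo P).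
Proof. by rewrite !mul_mpolyC comp_mpolyD comp_mpolyZ. Qed.

Lemma homog_addZ p q c d :
  p \is d.-homog -> q \is d.-homog -> p + c%:MP * q \is d.-homog.
Proof. by move=> p_hom q_hom; rewrite mul_mpolyC rpredD ?rpredZ. Qed.

Lemma addZK p q c : p + c%:MP * q + (- c)%:MP * q = p.
Proof. by rewrite -addrA -mulrDl -mpolyCD subrr mul0r addr0. Qed.

Lemma subZK p q c : p + (- c)%:MP * q + c%:MP * q = p.
Proof. by rewrite -addrA -mulrDl -mpolyCD addNr mul0r addr0. Qed.

Lemma shear_zx e : inverse_triples [tuple x; y; z + e%:MP * x]
                                   [tuple x; y; z + (- e)%:MP * x].
Proof.
apply: inverse_tuples; rewrite ?homog_addZ ?homogX //; split;
  by rewrite ?comp_addZ ?comp_z ?comp_y ?comp_x ?addZK ?subZK.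
Qed.

Lemma shear_zy e : inverse_triples [tuple x; y; z + e%:MP * y]
                                   [tuple x; y; z + (- e)%:MP * y].
Proof.
apply: inverse_tuples; rewrite ?homog_addZ ?homogX //; split;
  by rewrite ?comp_addZ ?comp_z ?comp_y ?comp_x ?addZK ?subZK.
Qed.

Lemma shear_xy e : inverse_triples [tuple x + e%:MP * y; y; z]
                                   [tuple x + (- e)%:MP * y; y; z].
Proof.
apply: inverse_tuples; rewrite ?homog_addZ ?homogX //; split;
  by rewrite ?comp_addZ ?comp_z ?comp_y ?comp_x ?addZK ?subZK.
Qed.

Lemma comp_scale p c P : (c%:MP * p) \mPo P = c%:MP * (p \mPo P).
Proof. by rewrite !mul_mpolyC comp_mpolyZ. Qed.

Lemma homog_scale p c d : p \is d.-homog -> c%:MP * p \is d.-homog.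
Proof. by move=> p_hom; rewrite mul_mpolyC rpredZ. Qed.

Lemma scaleK c p : c != 0 -> c%:MP * (c^-1%:MP * p) = p.
Proof. by move=> c0; rewrite mulrA -mpolyCM mulfV // mul1r. Qed.

Lemma scaleVK c p : c != 0 -> c^-1%:MP * (c%:MP * p) = p.
Proof. by move=> c0; rewrite mulrA -mpolyCM mulVf // mul1r. Qed.

Lemma addZ_scaleK c d p q :
  c != 0 -> p + (- (d / c))%:MP * q + d%:MP * (c^-1%:MP * q) = p.
Proof. by move=> c0; rewrite mulrA -mpolyCM subZK. Qed.

Lemma addZ_scaleVK c d p q :
  c != 0 -> p + d%:MP * q + (- (d / c))%:MP * (c%:MP * q) = p.
Proof. by move=> c0; rewrite mulrA -mpolyCM mulNr divfK // addZK. Qed.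

Lemma swap_xy : inverse_triples [tuple y; x; z] [tuple y; x; z].
Proof.
by apply: inverse_tuples; rewrite ?homogX //; split;
  rewrite ?comp_z ?comp_y ?comp_x.
Qed.

Lemma scale_xy a b : a != 0 -> b != 0 ->
  inverse_triples [tuple a%:MP * x; b%:MP * y; z]
                  [tuple a^-1%:MP * x; b^-1%:MP * y; z].
Proof.
move=> a0 b0; apply: inverse_tuples; rewrite ?homog_scale ?homogX //; split;
  by rewrite ?comp_scale ?comp_z ?comp_y ?comp_x ?scaleK ?scaleVK.
Qed.

(** This takes (0 : 0 : 1) to (a : b : c). The next two lemmas take it to (a : b : 0) and to (a : 0
    : 0). *)
Lemma move_point_z a b c : c != 0 ->
  inverse_triples
    [tuple x + a%:MP * z; y + b%:MP * z; c%:MP * z]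
    [tuple x + (- (a / c))%:MP * z; y + (- (b / c))%:MP * z; c^-1%:MP * z].
Proof.
move=> c0; apply: inverse_tuples; rewrite ?homog_addZ ?homog_scale ?homogX //;
  split; rewrite ?(comp_addZ, comp_scale) ?comp_z ?comp_y ?comp_x;
  by rewrite ?addZ_scaleK ?addZ_scaleVK ?scaleK ?scaleVK.
Qed.

Lemma move_point_y a b : b != 0 ->
  inverse_triples [tuple x + a%:MP * z; b%:MP * z; y]
                  [tuple x + (- (a / b))%:MP * y; z; b^-1%:MP * y].
Proof.
move=> b0; apply: inverse_tuples; rewrite ?homog_addZ ?homog_scale ?homogX //;
  split; rewrite ?(comp_addZ, comp_scale) ?comp_z ?comp_y ?comp_x;
  by rewrite ?addZ_scaleK ?addZ_scaleVK ?scaleK ?scaleVK.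
Qed.

Lemma move_point_x a : a != 0 ->
  inverse_triples [tuple a%:MP * z; x; y] [tuple y; z; a^-1%:MP * x].
Proof.
move=> a0; apply: inverse_tuples; rewrite ?homog_scale ?homogX //;
  by split; rewrite ?comp_scale ?comp_z ?comp_y ?comp_x ?scaleK ?scaleVK.
Qed.

Lemma scale_shear_yx a b : a != 0 ->
  inverse_triples [tuple x; a%:MP * y + b%:MP * x; z]
                  [tuple x; a^-1%:MP * y + (- (b / a))%:MP * x; z].
Proof.
move=> a0; apply: inverse_tuples; rewrite ?homog_addZ ?homog_scale ?homogX //;
  split; rewrite ?(comp_addZ, comp_scale) ?comp_z ?comp_y ?comp_x //.
- by rewrite mulrDr scaleK // mulrA -mpolyCM mulrN [a * _]mulrC divfK // subZK.
- by rewrite mulrDr scaleVK // mulrA -mpolyCM [_^-1 * _]mulrC addZK.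
Qed.

Lemma quartic_linearly_equivalent c s t p q r P : inverse_triples [tuple p; q; r] P ->
  c != 0 -> quartic_form const s p q r = c%:MP * quartic t ->
  linearly_equivalent (quartic s) (quartic t).
Proof.
move=> PQ c0 s_eq; exists [tuple p; q; r]; first by exists P.
exists c^-1; first by rewrite invr_eq0.
by rewrite quartic_comp s_eq -mul_mpolyC scaleVK.
Qed.

(** The new coefficients need not be computed: when the rational point is moved, only one value of
    the new quartic matters. *)
Lemma quartic_linear_substitution s p q r P :
  quartic s \is 4.-homog -> inverse_triples [tuple p; q; r] P ->
  exists2 t, quartic_form const s p q r = quartic t &
    linearly_equivalent (quartic s) (quartic t).
Proof.
move=> s_hom PQ; have [P_lin _ _ _] := PQ.
have [t] := homog4_quartic (comp_linear s_hom P_lin).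
rewrite quartic_comp => t_eq; exists t => //.
apply: (quartic_linearly_equivalent PQ (oner_neq0 _)).
by rewrite mul1r.
Qed.

(** * The rational point, its tangent line, and singular quartics *)

Lemma quartic_eval (L : fieldType) (f : {rmorphism k -> L}) v s :
  mmap f v (quartic s) = quartic_form f s (v 0) (v 1) (v 2%:R).
Proof.
rewrite /quartic (quartic_form_morph (g := mmap f v) (h := f)) => [|c] /=.
  by rewrite !mmapX !mmap1U.
exact: mmapC.
Qed.

(* The coefficient of z^4 is the value at (0 : 0 : 1). *)
Lemma rational_point_normalization F :
  F \is 4.-homog -> has_rational_point F ->
  exists2 s, s`_14 = 0 & linearly_equivalent F (quartic s).
Proof.
move=> F_hom [v [v0]]; have [s F_eq] := homog4_quartic F_hom.
rewrite {}F_eq in F_hom *; rewrite quartic_eval => /= s_v.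
(* Evaluation at (0 : 0 : 1), where z^4 is the only quartic monomial that does not vanish. *)
pose ev := mmap (idfun : k -> k) (fun i : 'I_3 => (i == 2%:R)%:R) : {rmorphism {mpoly k[3]} -> k}.
have evX i : ev 'X_i = (i == 2%:R)%:R by rewrite /ev /= mmapX mmap1U.
have evC c : ev c%:MP = c by exact: mmapC.
(* Any invertible substitution taking (0 : 0 : 1) to [v] will do: the new quartic takes there the
   value of the old one at [v], which is zero. *)
have normalize p q r P : inverse_triples [tuple p; q; r] P ->
    ev p = v 0 -> ev q = v 1 -> ev r = v 2%:R ->
    exists2 t, t`_14 = 0 & linearly_equivalent (quartic s) (quartic t).
  move=> PQ p_v q_v r_v.
  have [t t_eq s_t] := quartic_linear_substitution F_hom PQ; exists t => //.
  have := congr1 ev t_eq; rewrite !(quartic_form_morph (h := idfun)) //.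
  rewrite p_v q_v r_v s_v !evX /= /quartic_form /= => /esym.
  by rewrite ?(expr0n, expr1n, mulr0, mul0r, add0r, mulr1).
(* The substitution is chosen according to the last nonzero coordinate of [v]. *)
have [v2|v2] := eqVneq (v 2%:R) 0; last first.
  apply: normalize (move_point_z (v 0) (v 1) v2) _ _ _;
  by rewrite ?(rmorphD, rmorphM) ?evC !evX /= ?mulr1 ?add0r.
have [v1|v1] := eqVneq (v 1) 0; last first.
  apply: normalize (move_point_y (v 0) v1) _ _ _;
  by rewrite ?(rmorphD, rmorphM) ?evC !evX /= ?mulr1 ?add0r ?v2.
have [v00|v00] := eqVneq (v 0) 0; last first.
  apply: normalize (move_point_x v00) _ _ _;
  by rewrite ?(rmorphD, rmorphM) ?evC !evX /= ?mulr1 ?add0r ?v2 ?v1.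
case: v0 => -[[|[|[|//]]] i_lt] /negP[]; apply/eqP.
- by rewrite -[RHS]v00; congr v; apply: val_inj.
- by rewrite -[RHS]v1; congr v; apply: val_inj.
- by rewrite -[RHS]v2; congr v; apply: val_inj.
Qed.

(** Every remaining monomial has degree at least 2 in x and y, so the quartic is x p + y q with p
    and q also vanishing at (0 : 0 : 1). *)
Lemma quartic_singular_at_z s : s`_9 = 0 -> s`_13 = 0 -> s`_14 = 0 ->
  ~ nonsingular (quartic s).
Proof.
move=> s9 s13 s14 s_ns.
pose p := const s`_0 * x ^+ 3 + const s`_1 * (x ^+ 2 * y) + const s`_2 * (x ^+ 2 * z)
  + const s`_3 * (x * y ^+ 2) + const s`_4 * (x * y * z) + const s`_5 * (x * z ^+ 2).
pose q := const s`_6 * (x * y ^+ 2) + const s`_7 * (x * y * z)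
  + const s`_8 * (x * z ^+ 2) + const s`_10 * y ^+ 3 + const s`_11 * (y ^+ 2 * z)
  + const s`_12 * (y * z ^+ 2).
have evX i : mmap (idfun : k -> k) (fun i : 'I_3 => (i == 2%:R)%:R) 'X_i = (i == 2%:R)%:R.
  by rewrite mmapX mmap1U.
apply: (s_ns k idfun (fun i : 'I_3 => (i == 2%:R)%:R) x p y q); rewrite ?evX //.
- by exists 2%:R; rewrite eqxx oner_neq0.
- by rewrite /p !(rmorphD, rmorphM, rmorphXn) /= !evX /=; ring.
- by rewrite /q !(rmorphD, rmorphM, rmorphXn) /= !evX /=; ring.
by rewrite /quartic /quartic_form s9 s13 s14 /p /q; ring.
Qed.

(** All monomials free of y are absent, so the quartic is y p. The cubic p meets the line y = 0 at
    (1 : 0 : t) for any root t of s_1 + s_4 t + s_8 t^2 + t^3, possibly in an extension, and the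
    quartic is singular there. *)
Lemma quartic_singular_on_y s : s`_0 = 0 -> s`_2 = 0 -> s`_5 = 0 ->
  s`_9 = 0 -> s`_13 = 1 -> s`_14 = 0 -> ~ nonsingular (quartic s).
Proof.
move=> s0 s2 s5 s9 s13 s14 s_ns.
pose p := const s`_1 * x ^+ 3 + const s`_3 * (x ^+ 2 * y) + const s`_4 * (x ^+ 2 * z)
  + const s`_6 * (x * y ^+ 2) + const s`_7 * (x * y * z) + const s`_8 * (x * z ^+ 2)
  + const s`_10 * y ^+ 3 + const s`_11 * (y ^+ 2 * z)
  + const s`_12 * (y * z ^+ 2) + z ^+ 3.
apply: (@cubic_root_extension k s`_8 s`_4 s`_1) => L f t; apply/eqP => root_t.
pose v (i : 'I_3) : L := if i == 0 then 1 else if i == 1 then 0 else t.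
have evX i : mmap f v 'X_i = v i by rewrite mmapX mmap1U.
apply: (s_ns L f v y p 0 0); rewrite ?evX ?rmorph0 //.
- by exists 0; rewrite oner_neq0.
- rewrite /p !(rmorphD, rmorphM, rmorphXn) /= !evX !mmapC /v /= -[RHS]root_t; ring.
by rewrite /quartic /quartic_form s0 s2 s5 s9 s13 s14 /p; ring.
Qed.

Lemma quartic_substitution_equivalent s t p q r P :
  inverse_triples [tuple p; q; r] P ->
  quartic_form const s p q r = quartic t ->
  linearly_equivalent (quartic s) (quartic t).
Proof.
move=> PQ s_t; apply: (quartic_linearly_equivalent PQ (oner_neq0 _)).
by rewrite mul1r.
Qed.

Lemma swap_equivalent s :
  linearly_equivalent (quartic s) (quartic
      [:: s`_10; s`_6; s`_11; s`_3; s`_7; s`_12; s`_1; s`_4; s`_8; s`_13;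
          s`_0; s`_2; s`_5; s`_9; s`_14]).
Proof.
exact: quartic_substitution_equivalent swap_xy (quartic_form_swap _ s x y z).
Qed.

Lemma tangent_normalization_swapped s : s`_14 = 0 -> s`_13 != 0 ->
  exists m1 m2 m3 m4 m5 m6 m7 m8 m9 m11 m12 m13,
    linearly_equivalent (quartic s)
      (quartic [:: m1; m2; m3; m4; m5; m6; m7; m8; m9; 0; m11; m12; m13; 1]).
Proof.
(* Chosen so that substituting a y + b x for y turns s_9 x + s_13 y into y. *)
move=> s14 s13; pose a := (s`_13)^-1; pose b := - (s`_9 / s`_13).
have a0 : a != 0 by rewrite invr_eq0.
have a1 : a * s`_13 = 1 by rewrite mulVf.
have b0 : s`_9 + b * s`_13 = 0 by rewrite mulNr divfK ?subrr.
have := quartic_substitution_equivalent (scale_shear_yx b a0)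
  (quartic_form_shear_yx const a b s x y z).
(* The final 0 of the fifteen coefficients agrees by computation with the default value read past
   the end of the fourteen listed in the goal. *)
rewrite a1 b0 s14 => s_t; do 12 eexists; exact: s_t.
Qed.

(** If s_13 = 0 then s_9 is nonzero, as (0 : 0 : 1) would be singular otherwise, and exchanging x
    and y puts s_9 in the place of s_13. *)
Lemma tangent_normalization s : s`_14 = 0 -> nonsingular (quartic s) ->
  exists m1 m2 m3 m4 m5 m6 m7 m8 m9 m11 m12 m13,
    linearly_equivalent (quartic s)
      (quartic [:: m1; m2; m3; m4; m5; m6; m7; m8; m9; 0; m11; m12; m13; 1]).
Proof.
move=> s14 s_ns; have [s13|] := eqVneq s`_13 0; last first.
  exact: tangent_normalization_swapped.
have [s9|s9] := eqVneq s`_9 0; first by case: (quartic_singular_at_z s9 s13 s14).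
have st := swap_equivalent s.
have [||m1 [m2 [m3 [m4 [m5 [m6 [m7 [m8 [m9 [m11 [m12 [m13 t_m]]]]]]]]]]]] :=
  @tangent_normalization_swapped [:: s`_10; s`_6; s`_11; s`_3; s`_7; s`_12;
    s`_1; s`_4; s`_8; s`_13; s`_0; s`_2; s`_5; s`_9; s`_14] => //.
exists m1, m2, m3, m4, m5, m6, m7, m8, m9, m11, m12, m13.
exact: linearly_equivalent_trans st t_m.
Qed.

(** * Shears that remove coefficients *)

Local Notation "s ~ t" := (linearly_equivalent (quartic s) (quartic t))
  (at level 70).

Lemma shear_zx_equivalent (e : k) {m1 m2 m3 m4 m5 m6 m7 m8 m9 m11 m12 m13 : k} :
  [:: m1; m2; m3; m4; m5; m6; m7; m8; m9; 0; m11; m12; m13; 1]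
  ~ [:: m1 + e * m3 + e ^+ 2 * m6; m2 + e * m5 + e ^+ 2 * m9 + e ^+ 3;
        m3 + 2 * e * m6; m4 + e * m8 + e ^+ 2 * m13;
        m5 + 2 * e * m9 + 3 * e ^+ 2; m6; m7 + e * m12; m8 + 2 * e * m13;
        m9 + 3 * e; 0; m11; m12; m13; 1].
Proof.
apply: quartic_substitution_equivalent (shear_zx e) _.
exact: quartic_form_shear_zx.
Qed.

Lemma shear_zy_equivalent (e : k) {m1 m2 m3 m4 m5 m6 m7 m8 m9 m11 m12 m13 : k} :
  [:: m1; m2; m3; m4; m5; m6; m7; m8; m9; 0; m11; m12; m13; 1]
  ~ [:: m1; m2 + e * m3; m3; m4 + e * m5 + e ^+ 2 * m6; m5 + 2 * e * m6; m6;
        m7 + e * m8 + e ^+ 2 * m9; m8 + 2 * e * m9; m9; 0;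
        m11 + e * m12 + e ^+ 2 * m13 + e ^+ 3;
        m12 + 2 * e * m13 + 3 * e ^+ 2; m13 + 3 * e; 1].
Proof.
apply: quartic_substitution_equivalent (shear_zy e) _.
exact: quartic_form_shear_zy.
Qed.

Lemma shear_xy_equivalent (e : k) {m1 m2 m3 m4 m5 m6 m7 m8 m9 m11 m12 m13 : k} :
  [:: m1; m2; m3; m4; m5; m6; m7; m8; m9; 0; m11; m12; m13; 1]
  ~ [:: m1; m2 + 4 * e * m1; m3; m4 + 6 * e ^+ 2 * m1 + 3 * e * m2;
        m5 + 3 * e * m3; m6;
        m7 + 4 * e ^+ 3 * m1 + 3 * e ^+ 2 * m2 + 2 * e * m4;
        m8 + 3 * e ^+ 2 * m3 + 2 * e * m5; m9 + 2 * e * m6; 0;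
        m11 + e ^+ 4 * m1 + e ^+ 3 * m2 + e ^+ 2 * m4 + e * m7;
        m12 + e ^+ 3 * m3 + e ^+ 2 * m5 + e * m8;
        m13 + e ^+ 2 * m6 + e * m9; 1].
Proof.
apply: quartic_substitution_equivalent (shear_xy e) _.
exact: quartic_form_shear_xy.
Qed.

Lemma scale_equivalent (a b : k) {m1 m2 m3 m4 m5 m6 m7 m8 m9 m11 m12 m13 : k} :
  a != 0 -> b != 0 ->
  [:: m1; m2; m3; m4; m5; m6; m7; m8; m9; 0; m11; m12; m13; 1]
  ~ [:: a ^+ 4 / b * m1; a ^+ 3 * m2; a ^+ 3 / b * m3; a ^+ 2 * b * m4;
        a ^+ 2 * m5; a ^+ 2 / b * m6; a * b ^+ 2 * m7; a * b * m8; a * m9; 0;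
        b ^+ 3 * m11; b ^+ 2 * m12; b * m13; 1].
Proof.
move=> a0 b0; apply: (quartic_linearly_equivalent (scale_xy a0 b0) b0).
exact: quartic_form_scale.
Qed.

(** Each shear changes its target by 2 e m6 and fixes m6. The zeros already obtained survive: m3 is
    fixed by the last two shears, and the last changes m5 only by a multiple of m3 = 0. *)
Lemma reduce_nonflex (m1 m2 m3 m4 m5 m6 m7 m8 m9 m11 m12 m13 : k) :
  2 != 0 :> k -> m6 != 0 ->
  exists n1 n2 n4 n7 n8 n11 n12 n13,
    [:: m1; m2; m3; m4; m5; m6; m7; m8; m9; 0; m11; m12; m13; 1]
    ~ [:: n1; n2; 0; n4; 0; m6; n7; n8; 0; 0; n11; n12; n13; 1].
Proof.
move=> k2 m60; have kill m : m + 2 * - (m / (2 * m6)) * m6 = 0.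
  by field; rewrite m60.
have := @shear_zx_equivalent (- (m3 / (2 * m6)))
  m1 m2 m3 m4 m5 m6 m7 m8 m9 m11 m12 m13.
rewrite kill; set n5 := m5 + _ + _ => step1.
have := linearly_equivalent_trans step1
  (shear_zy_equivalent (- (n5 / (2 * m6)))).
rewrite kill; set n9 := m9 + _ => step2.
have := linearly_equivalent_trans step2
  (shear_xy_equivalent (- (n9 / (2 * m6)))).
rewrite kill !mulr0 !addr0 => step3.
by do 8 eexists; exact: step3.
Qed.

(** With m6 = 0 all three shears fix m3, which serves as pivot: the targets m1, m2, m5 change by e
    m3, e m3 and 3 e m3. The last shear changes m2 only by a multiple of m1 = 0. *)
Lemma reduce_flex (m1 m2 m3 m4 m5 m7 m8 m9 m11 m12 m13 : k) :
  3 != 0 :> k -> m3 != 0 ->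
  exists n4 n7 n8 n9 n11 n12 n13,
    [:: m1; m2; m3; m4; m5; 0; m7; m8; m9; 0; m11; m12; m13; 1]
    ~ [:: 0; 0; m3; n4; 0; 0; n7; n8; n9; 0; n11; n12; n13; 1].
Proof.
move=> k3 m30; have kill m : m + - (m / m3) * m3 = 0 by field.
have := @shear_zx_equivalent (- (m1 / m3)) m1 m2 m3 m4 m5 0 m7 m8 m9 m11 m12 m13.
rewrite kill !mulr0 !addr0; set n2 := m2 + _ + _ + _ => step1.
have := linearly_equivalent_trans step1 (shear_zy_equivalent (- (n2 / m3))).
rewrite kill !mulr0 !addr0; set n5 := m5 + _ + _ => step2.
have := linearly_equivalent_trans step2
  (shear_xy_equivalent (- (n5 / (3 * m3)))).
have -> : n5 + 3 * - (n5 / (3 * m3)) * m3 = 0 by field; rewrite m30.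
rewrite !mulr0 !addr0 => step3.
by do 7 eexists; exact: step3.
Qed.

(** The pivots are the coefficient 1 of y z^3, giving 3 e for m9 and m13, and m1, giving 4 e m1 for
    m2. As m3 = m6 = 0, each zero obtained is left alone by the later shears. *)
Lemma reduce_hyperflex (m1 m2 m4 m5 m7 m8 m9 m11 m12 m13 : k) :
  2 != 0 :> k -> 3 != 0 :> k -> m1 != 0 ->
  exists n4 n5 n7 n8 n11 n12,
    [:: m1; m2; 0; m4; m5; 0; m7; m8; m9; 0; m11; m12; m13; 1]
    ~ [:: m1; 0; 0; n4; n5; 0; n7; n8; 0; 0; n11; n12; 0; 1].
Proof.
move=> k2 k3 m10; have kill (m : k) : m + 3 * - (m / 3) = 0 by field.
have := @shear_zx_equivalent (- (m9 / 3)) m1 m2 0 m4 m5 0 m7 m8 m9 m11 m12 m13.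
rewrite kill !mulr0 !addr0; set n2 := m2 + _ + _ + _ => step1.
have := linearly_equivalent_trans step1
  (shear_xy_equivalent (- (n2 / (4 * m1)))).
have -> : n2 + 4 * - (n2 / (4 * m1)) * m1 = 0.
  by field; rewrite m10 (_ : 4 = 2 * 2) ?mulf_neq0 //; ring.
rewrite !mulr0 !addr0 => step2.
have := linearly_equivalent_trans step2 (shear_zy_equivalent (- (m13 / 3))).
rewrite kill !mulr0 !addr0 => step3.
by do 6 eexists; exact: step3.
Qed.

(** * The ten normal forms and the scalings that reach them *)

Inductive normal_form : seq k -> Prop :=
| Normal1 m1 m2 m4 m6 m7 m11 m12 :
  normal_form [:: m1; m2; 0; m4; 0; m6; m7; 1; 0; 0; m11; m12; 1; 1]
| Normal2 m1 m2 m4 m6 m11 m12 :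
  normal_form [:: m1; m2; 0; m4; 0; m6; 1; 0; 0; 0; m11; m12; 1; 1]
| Normal3 m1 m2 m4 m6 m11 m12 :
  normal_form [:: m1; m2; 0; m4; 0; m6; 0; 0; 0; 0; m11; m12; 1; 1]
| Normal4 m1 m2 m4 m6 m11 m12 :
  normal_form [:: m1; m2; 0; m4; 0; m6; 1; 1; 0; 0; m11; m12; 0; 1]
| Normal5 m1 m2 m4 m6 m11 m12 :
  normal_form [:: m1; m2; 0; m4; 0; m6; 0; 1; 0; 0; m11; m12; 0; 1]
| Normal6 m2 m4 m6 m7 m11 m12 :
  normal_form [:: 1; m2; 0; m4; 0; m6; m7; 0; 0; 0; m11; m12; 0; 1]
| Normal7 m2 m4 m6 m7 m11 m12 :
  normal_form [:: 0; m2; 0; m4; 0; m6; m7; 0; 0; 0; m11; m12; 0; 1]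
| Normal8 m4 m7 m8 m11 m12 m13 :
  normal_form [:: 0; 0; 1; m4; 0; 0; m7; m8; 1; 0; m11; m12; m13; 1]
| Normal9 m4 m7 m8 m11 m12 m13 :
  normal_form [:: 0; 0; 1; m4; 0; 0; m7; m8; 0; 0; m11; m12; m13; 1]
| Normal10 m4 m5 m7 m8 m11 m12 :
  normal_form [:: 1; 0; 0; m4; m5; 0; m7; m8; 0; 0; m11; m12; 0; 1].

Definition has_normal_form F :=
  exists2 t, normal_form t & linearly_equivalent F (quartic t).

Lemma linearly_equivalent_normal_form F G :
  linearly_equivalent F G -> has_normal_form G -> has_normal_form F.
Proof.
move=> FG [t t_normal Gt]; exists t; first exact: t_normal.
exact: linearly_equivalent_trans FG Gt.
Qed.

(** Scaling multiplies m13, m8, m7 and m1 by b, a b, a b^2 and a^4 / b. The case split looks for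
    nonzero coefficients in this order and sets up to two of them to 1. *)
Lemma nonflex_normal_form (m1 m2 m4 m6 m7 m8 m11 m12 m13 : k) :
  has_normal_form
    (quartic [:: m1; m2; 0; m4; 0; m6; m7; m8; 0; 0; m11; m12; m13; 1]).
Proof.
have scale a b a0 b0 := @scale_equivalent a b m1 m2 0 m4 0 m6 m7 m8 0 m11 m12 m13 a0 b0.
have one0 := oner_neq0 k.
have [m13_0|m13_0] := eqVneq m13 0; last first.
  have b0 : m13^-1 != 0 by rewrite invr_eq0.
  have [m8_0|m8_0] := eqVneq m8 0; last first.
    (* With b = 1 / m13, this a solves a b m8 = 1. *)
    have a0 : m13 / m8 != 0 by rewrite mulf_neq0 ?invr_eq0.
    have := scale _ _ a0 b0; rewrite !mulr0 mulVf //.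
    rewrite (_ : m13 / m8 / m13 * m8 = 1); last by field; apply/andP.
    by move=> s; eexists; last exact: s; exact: Normal1.
  have [m7_0|m7_0] := eqVneq m7 0; last first.
    (* With b = 1 / m13, this a solves a b^2 m7 = 1. *)
    have a0 : m13 ^+ 2 / m7 != 0 by rewrite mulf_neq0 ?invr_eq0 ?expf_neq0.
    have := scale _ _ a0 b0; rewrite m8_0 !mulr0 mulVf //.
    rewrite (_ : m13 ^+ 2 / m7 * m13^-1 ^+ 2 * m7 = 1); last by field; apply/andP.
    by move=> s; eexists; last exact: s; exact: Normal2.
  have := scale _ _ one0 b0; rewrite m8_0 m7_0 !mulr0 mulVf //.
  by move=> s; eexists; last exact: s; exact: Normal3.
have [m8_0|m8_0] := eqVneq m8 0; last first.
  have [m7_0|m7_0] := eqVneq m7 0; last first.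
    (* The pair solves a b m8 = 1 and a b^2 m7 = 1 at once. *)
    have b0 : m8 / m7 != 0 by rewrite mulf_neq0 ?invr_eq0.
    have a0 : m7 / m8 ^+ 2 != 0 by rewrite mulf_neq0 ?invr_eq0 ?expf_neq0.
    have := scale _ _ a0 b0; rewrite m13_0 !mulr0.
    rewrite (_ : m7 / m8 ^+ 2 * (m8 / m7) * m8 = 1); last by field; apply/andP.
    rewrite (_ : m7 / m8 ^+ 2 * (m8 / m7) ^+ 2 * m7 = 1); last by field; apply/andP.
    by move=> s; eexists; last exact: s; exact: Normal4.
  have a0 : m8^-1 != 0 by rewrite invr_eq0.
  have := scale _ _ a0 one0; rewrite m13_0 m7_0 !mulr0 [m8^-1 * 1]mulr1 mulVf //.
  by move=> s; eexists; last exact: s; exact: Normal5.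
have [m1_0|m1_0] := eqVneq m1 0; last first.
  have := scale _ _ one0 m1_0; rewrite m13_0 m8_0 !mulr0.
  rewrite [1 ^+ 4]expr1n [1 / _]mul1r mulVf //.
  by move=> s; eexists; last exact: s; exact: Normal6.
rewrite m1_0 m13_0 m8_0; eexists; last exact: linearly_equivalent_refl.
exact: Normal7.
Qed.

Lemma flex_normal_form (m3 m4 m7 m8 m9 m11 m12 m13 : k) : m3 != 0 ->
  has_normal_form
    (quartic [:: 0; 0; m3; m4; 0; 0; m7; m8; m9; 0; m11; m12; m13; 1]).
Proof.
move=> m3_0.
have scale a b a0 b0 := @scale_equivalent a b 0 0 m3 m4 0 0 m7 m8 m9 m11 m12 m13 a0 b0.
(* Taking b = a^3 m3 makes the coefficient of x^3 z equal to 1 for every nonzero a, which leaves a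
   free to normalize m9. *)
have kill a : a != 0 -> a ^+ 3 / (a ^+ 3 * m3) * m3 = 1.
  by move=> a0; field; apply/andP.
have [m9_0|m9_0] := eqVneq m9 0; last first.
  have a0 : m9^-1 != 0 by rewrite invr_eq0.
  have b0 : m9^-1 ^+ 3 * m3 != 0 by rewrite mulf_neq0 ?expf_neq0.
  have := scale _ _ a0 b0; rewrite kill // !mulr0 mulVf //.
  by move=> s; eexists; last exact: s; exact: Normal8.
have b0 : 1 ^+ 3 * m3 != 0 by rewrite expr1n mul1r.
have := scale _ _ (oner_neq0 k) b0; rewrite kill ?oner_neq0 // m9_0 !mulr0.
by move=> s; eexists; last exact: s; exact: Normal9.
Qed.

Lemma hyperflex_normal_form (m1 m4 m5 m7 m8 m11 m12 : k) : m1 != 0 ->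
  has_normal_form
    (quartic [:: m1; 0; 0; m4; m5; 0; m7; m8; 0; 0; m11; m12; 0; 1]).
Proof.
move=> m1_0.
have := @scale_equivalent 1 m1 m1 0 0 m4 m5 0 m7 m8 0 m11 m12 0 (oner_neq0 k) m1_0.
rewrite [1 ^+ 4]expr1n [1 / _]mul1r mulVf // !mulr0.
by move=> s; eexists; last exact: s; exact: Normal10.
Qed.

End PlaneQuartics.

(** * Contact of the tangent line with the curve, and conclusion *)

Lemma smooth_quartic_normal_form (k : fieldType) (F : {mpoly k[3]}) :
  2 != 0 :> k -> 3 != 0 :> k -> F \is 4.-homog -> smooth_curve F ->
  has_rational_point F -> has_normal_form F.
Proof.
move=> k2 k3 F_hom F_smooth F_point.
have [s s14 F_s] := rational_point_normalization F_hom F_point.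
have s_ns : nonsingular (quartic s).
  exact: linearly_equivalent_nonsingular F_s (smooth_nonsingular F_smooth).
apply: linearly_equivalent_normal_form F_s _.
have [m1 [m2 [m3 [m4 [m5 [m6 [m7 [m8 [m9 [m11 [m12 [m13 s_t]]]]]]]]]]]] :=
  tangent_normalization s14 s_ns.
have {s14 s_ns}t_ns := linearly_equivalent_nonsingular s_t s_ns.
apply: linearly_equivalent_normal_form s_t _.
have [m6_0|m6_0] := eqVneq m6 0; last first.
  have [n1 [n2 [n4 [n7 [n8 [n11 [n12 [n13 t_u]]]]]]]] :=
    reduce_nonflex m1 m2 m3 m4 m5 m7 m8 m9 m11 m12 m13 k2 m6_0.
  apply: linearly_equivalent_normal_form t_u _.
  exact: nonflex_normal_form.
rewrite {}m6_0 in t_ns *; have [m3_0|m3_0] := eqVneq m3 0; last first.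
  have [n4 [n7 [n8 [n9 [n11 [n12 [n13 t_u]]]]]]] :=
    reduce_flex m1 m2 m4 m5 m7 m8 m9 m11 m12 m13 k3 m3_0.
  apply: linearly_equivalent_normal_form t_u _.
  exact: flex_normal_form.
rewrite {}m3_0 in t_ns *; have [m1_0|m1_0] := eqVneq m1 0.
  (* With m1 = m3 = m6 = 0 the tangent line y = 0 would be a component, against nonsingularity. *)
  by case: (quartic_singular_on_y _ _ _ _ _ _ t_ns).
have [n4 [n5 [n7 [n8 [n11 [n12 t_u]]]]]] :=
  reduce_hyperflex m2 m4 m5 m7 m8 m9 m11 m12 m13 k2 k3 m1_0.
apply: linearly_equivalent_normal_form t_u _.
exact: hyperflex_normal_form.
Qed.

Theorem proposition3p7 (k : fieldType)
    (char_neq2 : 2%N \notin [pchar k]) (char_neq3 : 3%N \notin [pchar k])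
    (C : {mpoly k[3]}) (quarticC : plane_quartic C) (smoothC : smooth_curve C)
    (pointC : has_rational_point C) :
  let x : {mpoly k[3]} := 'X_(0 : 'I_3) in
  let y : {mpoly k[3]} := 'X_(1 : 'I_3) in
  let z : {mpoly k[3]} := 'X_(2%:R : 'I_3) in
  exists (m1 m2 m4 m5 m6 m7 m8 m11 m12 m13 : k) (D : {mpoly k[3]}),
    isomorphic_curves C D /\
    (D = m1 *: x ^+ 4 + m2 *: (x ^+ 3 * y) + m4 *: (x ^+ 2 * y ^+ 2)
         + m6 *: (x ^+ 2 * z ^+ 2) + m7 *: (x * y ^+ 3) + x * y ^+ 2 * z
         + m11 *: y ^+ 4 + m12 *: (y ^+ 3 * z) + y ^+ 2 * z ^+ 2 + y * z ^+ 3
     \/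
     D = m1 *: x ^+ 4 + m2 *: (x ^+ 3 * y) + m4 *: (x ^+ 2 * y ^+ 2)
         + m6 *: (x ^+ 2 * z ^+ 2) + x * y ^+ 3
         + m11 *: y ^+ 4 + m12 *: (y ^+ 3 * z) + y ^+ 2 * z ^+ 2 + y * z ^+ 3
     \/
     D = m1 *: x ^+ 4 + m2 *: (x ^+ 3 * y) + m4 *: (x ^+ 2 * y ^+ 2)
         + m6 *: (x ^+ 2 * z ^+ 2)
         + m11 *: y ^+ 4 + m12 *: (y ^+ 3 * z) + y ^+ 2 * z ^+ 2 + y * z ^+ 3
     \/
     D = m1 *: x ^+ 4 + m2 *: (x ^+ 3 * y) + m4 *: (x ^+ 2 * y ^+ 2)
         + m6 *: (x ^+ 2 * z ^+ 2) + x * y ^+ 3 + x * y ^+ 2 * z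
         + m11 *: y ^+ 4 + m12 *: (y ^+ 3 * z) + y * z ^+ 3
     \/
     D = m1 *: x ^+ 4 + m2 *: (x ^+ 3 * y) + m4 *: (x ^+ 2 * y ^+ 2)
         + m6 *: (x ^+ 2 * z ^+ 2) + x * y ^+ 2 * z
         + m11 *: y ^+ 4 + m12 *: (y ^+ 3 * z) + y * z ^+ 3
     \/
     D = x ^+ 4 + m2 *: (x ^+ 3 * y) + m4 *: (x ^+ 2 * y ^+ 2)
         + m6 *: (x ^+ 2 * z ^+ 2) + m7 *: (x * y ^+ 3)
         + m11 *: y ^+ 4 + m12 *: (y ^+ 3 * z) + y * z ^+ 3
     \/
     D = m2 *: (x ^+ 3 * y) + m4 *: (x ^+ 2 * y ^+ 2)
         + m6 *: (x ^+ 2 * z ^+ 2) + m7 *: (x * y ^+ 3)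
         + m11 *: y ^+ 4 + m12 *: (y ^+ 3 * z) + y * z ^+ 3
     \/
     D = x ^+ 3 * z + m4 *: (x ^+ 2 * y ^+ 2) + m7 *: (x * y ^+ 3)
         + m8 *: (x * y ^+ 2 * z) + x * y * z ^+ 2
         + m11 *: y ^+ 4 + m12 *: (y ^+ 3 * z) + m13 *: (y ^+ 2 * z ^+ 2)
         + y * z ^+ 3
     \/
     D = x ^+ 3 * z + m4 *: (x ^+ 2 * y ^+ 2) + m7 *: (x * y ^+ 3)
         + m8 *: (x * y ^+ 2 * z)
         + m11 *: y ^+ 4 + m12 *: (y ^+ 3 * z) + m13 *: (y ^+ 2 * z ^+ 2)
         + y * z ^+ 3
     \/
     D = x ^+ 4 + m4 *: (x ^+ 2 * y ^+ 2) + m5 *: (x ^+ 2 * y * z)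
         + m7 *: (x * y ^+ 3) + m8 *: (x * y ^+ 2 * z)
         + m11 *: y ^+ 4 + m12 *: (y ^+ 3 * z) + y * z ^+ 3).
Proof.
move=> x y z; have k2 : 2 != 0 :> k by move: char_neq2; rewrite inE.
have k3 : 3 != 0 :> k by move: char_neq3; rewrite inE.
have [t t_normal /linearly_equivalent_isomorphic] :=
  smooth_quartic_normal_form k2 k3 (proj2 quarticC) smoothC pointC.
case: t_normal =>
  [m1 m2 m4 m6 m7 m11 m12|m1 m2 m4 m6 m11 m12|m1 m2 m4 m6 m11 m12
  |m1 m2 m4 m6 m11 m12|m1 m2 m4 m6 m11 m12|m2 m4 m6 m7 m11 m12
  |m2 m4 m6 m7 m11 m12|m4 m7 m8 m11 m12 m13
  |m4 m7 m8 m11 m12 m13|m4 m5 m7 m8 m11 m12] C_t.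
(* One list of parameters serves all ten forms; those absent from the form at hand receive the
   arbitrary value 0. *)
- exists m1, m2, m4, 0, m6, m7, 0, m11, m12, 0; eexists; split; first exact: C_t.
  by left; rewrite /quartic /quartic_form /= -!mul_mpolyC /x /y /z; ring.
- exists m1, m2, m4, 0, m6, 0, 0, m11, m12, 0; eexists; split; first exact: C_t.
  by do 1 right; left; rewrite /quartic /quartic_form /= -!mul_mpolyC /x /y /z; ring.
- exists m1, m2, m4, 0, m6, 0, 0, m11, m12, 0; eexists; split; first exact: C_t.
  by do 2 right; left; rewrite /quartic /quartic_form /= -!mul_mpolyC /x /y /z; ring.
- exists m1, m2, m4, 0, m6, 0, 0, m11, m12, 0; eexists; split; first exact: C_t.
  by do 3 right; left; rewrite /quartic /quartic_form /= -!mul_mpolyC /x /y /z; ring.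
- exists m1, m2, m4, 0, m6, 0, 0, m11, m12, 0; eexists; split; first exact: C_t.
  by do 4 right; left; rewrite /quartic /quartic_form /= -!mul_mpolyC /x /y /z; ring.
- exists 0, m2, m4, 0, m6, m7, 0, m11, m12, 0; eexists; split; first exact: C_t.
  by do 5 right; left; rewrite /quartic /quartic_form /= -!mul_mpolyC /x /y /z; ring.
- exists 0, m2, m4, 0, m6, m7, 0, m11, m12, 0; eexists; split; first exact: C_t.
  by do 6 right; left; rewrite /quartic /quartic_form /= -!mul_mpolyC /x /y /z; ring.
- exists 0, 0, m4, 0, 0, m7, m8, m11, m12, m13; eexists; split; first exact: C_t.
  by do 7 right; left; rewrite /quartic /quartic_form /= -!mul_mpolyC /x /y /z; ring.
- exists 0, 0, m4, 0, 0, m7, m8, m11, m12, m13; eexists; split; first exact: C_t.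
  by do 8 right; left; rewrite /quartic /quartic_form /= -!mul_mpolyC /x /y /z; ring.
- exists 0, 0, m4, m5, 0, m7, m8, m11, m12, 0; eexists; split; first exact: C_t.
  by do 9 right; rewrite /quartic /quartic_form /= -!mul_mpolyC /x /y /z; ring.
Qed.
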